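(* Let $H_1$ and $H_2$ be Hermitian spaces over the sfields $F_1$ and $F_2$, respectively. Let $\phi \colon H_1 \to H_2$ be a quasilinear map and let $f = \mathbf P(\phi)\colon \mathbf P(H_1)\to\mathbf P(H_2)$, $\langle u\rangle\mapsto\langle\phi(u)\rangle$. Then there is a Hermitian space $H_2'$ over the sfield $F_1$ and an orthoisomorphism $t \colon \mathbf P(H_2) \to \mathbf P(H_2')$ such that $t \circ f$ is induced by a linear map from $H_1$ to $H_2'$; that is, there is a linear map $\phi'\colon H_1\to H_2'$ with $t(f(\langle u\rangle))=\langle\phi'(u)\rangle$ for all $u\in H_1$.
   Context: A sfield is a skew field (division ring). A $\ast$-sfield is a sfield $F$ with an involutory antiautomorphism $\ast \colon F \to F$. A Hermitian space over a $\ast$-sfield $F$ is a (left) linear space $H$ over $F$ with a map $(\cdot,\cdot)\colon H\times H\to F$ such that $(\alpha u+\beta v,w)=\alpha(u,w)+\beta(v,w)$, $(w,\alpha u+\beta v)=(w,u)\alpha^\ast+(w,v)\beta^\ast$, $(u,v)=(v,u)^\ast$ for all $u,v,w\in H$, $\alpha,\beta\in F$, and which is anisotropic: $(u,u)=0$ implies $u=0$. We write $u\perp v$ if $(u,v)=0$. Standing assumption: a Hermitian space contains at most countably many mutually orthogonal nonzero vectors. ''A Hermitian space over the sfield $F_1$'' means a Hermitian space whose scalar sfield is $F_1$, equipped with some involutory antiautomorphism; the involutions of $F_1$ associated with $H_1$ and with $H_2'$ need not coincide. A map $\phi\colon H_1\to H_2$ is quasilinear if it is additive and there is an isomorphism of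 sfields $\sigma\colon F_1\to F_2$ with $\phi(\alpha u)=\alpha^\sigma\phi(u)$ for all $u\in H_1$, $\alpha\in F_1$. An orthoset is a set $X$ with a symmetric binary relation $\perp$ and a constant $0$ such that $x\perp x$ if and only if $x=0$, and $0\perp x$ for all $x\in X$. An orthoisomorphism between orthosets is a bijection $t\colon X\to Y$ such that $x\perp y$ if and only if $t(x)\perp t(y)$, for all $x,y\in X$. For a Hermitian space $H$, $\mathbf P(H)=\{\langle u\rangle: u\in H\}$ is the set of at most one-dimensional subspaces of $H$ ($\langle u\rangle$ denotes the linear span of $u$), viewed as an orthoset with $\langle u\rangle\perp\langle v\rangle$ if $u\perp v$ and with the zero subspace $\{0\}$ as the constant $0$. *)

(* Defs.v *)
From HB Require Import structures.
From mathcomp Require Import all_boot all_algebra.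
From mathcomp Require Import boolp classical_sets cardinality.

Set Implicit Arguments.
Unset Strict Implicit.
Unset Printing Implicit Defensive.

Import GRing.Theory.
Local Open Scope ring_scope.
Local Open Scope classical_set_scope.

HB.mixin Record UnitRing_isSField F of GRing.UnitRing F := {
  sfieldP : forall x : F, x != 0 -> x \is a GRing.unit }.

#[short(type="sfieldType")]
HB.structure Definition SField := {F of GRing.UnitRing F & UnitRing_isSField F}.

Record involution (F : sfieldType) := Involution {
  star :> F -> F;
  starD : {morph star : a b / a + b};
  starM : forall a b, star (a * b) = star b * star a;
  starK : involutive star }.

(* The library's sesquilinear forms scale the second argument by a left
   multiplication, whereas over a noncommutative F the scalar must come out
   on the right. *)
HB.mixin Record isHermitianSpace (F : sfieldType) (s : involution F) H
    of GRing.Lmodule F H := {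
  form : H -> H -> F;
  form_linearl : forall (a b : F) (u v w : H),
    form (a *: u + b *: v) w = a * form u w + b * form v w;
  form_linearr : forall (a b : F) (u v w : H),
    form w (a *: u + b *: v) = form w u * s a + form w v * s b;
  form_sym : forall u v : H, form u v = s (form v u);
  form_anisotropic : forall u : H, form u u = 0 -> u = 0;
  orthogonal_countable : forall S : set H,
    (forall u, S u -> u <> 0) ->
    (forall u v, S u -> S v -> u <> v -> form u v = 0) ->
    countable S }.

#[short(type="hermitianSpaceType")]
HB.structure Definition HermitianSpace (F : sfieldType) (s : involution F) :=
  {H of GRing.Lmodule F H & isHermitianSpace F s H}.

Definition quasilinear (F1 F2 : sfieldType) (H1 : lmodType F1)
    (H2 : lmodType F2) (phi : H1 -> H2) : Prop :=
  {morph phi : u v / u + v} /\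
  exists2 sigma : {rmorphism F1 -> F2}, bijective sigma &
    forall (a : F1) (u : H1), phi (a *: u) = sigma a *: phi u.

HB.mixin Record isOrthoset X := {
  perp : X -> X -> Prop;
  ozero : X;
  perp_sym : forall x y, perp x y -> perp y x;
  perpxx : forall x, perp x x <-> x = ozero;
  perp0x : forall x, perp ozero x }.

#[short(type="orthosetType")]
HB.structure Definition Orthoset := {X of isOrthoset X}.

Definition orthoisomorphism (X Y : orthosetType) (t : X -> Y) : Prop :=
  bijective t /\ forall x y : X, perp x y <-> perp (t x) (t y).

Section Projective.
Context (F : sfieldType) (H : lmodType F).

Definition line (u : H) : set H := [set v | exists a : F, v = a *: u].

Lemma line0 : line 0 = [set 0].
Proof.
apply/seteqP; split=> v /=; first by case=> a ->; rewrite scaler0.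
by move=> ->; exists 0; rewrite scaler0.
Qed.

Lemma line_refl u : line u u.
Proof. by exists 1; rewrite scale1r. Qed.

Definition proj : Type := {A : set H | exists u, A = line u}.

Definition pline (u : H) : proj := exist _ (line u) (ex_intro _ u erefl).

Lemma plineP (x : proj) : exists u, x = pline u.
Proof. by case: x => A [u uE]; exists u; exact: eq_exist. Qed.

Definition prepr (x : proj) : H := sval (cid (plineP x)).

Lemma preprK x : pline (prepr x) = x.
Proof. by rewrite /prepr; case: cid. Qed.

Lemma pline_eq u v : pline u = pline v <-> line u = line v.
Proof.
by split=> [/(congr1 sval)//|e]; exact: eq_exist.
Qed.

End Projective.

Section ProjectiveOrthoset.
Context (F : sfieldType) (s : involution F) (H : hermitianSpaceType s).

Definition pperp (x y : proj H) : Prop :=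
  exists u v : H, [/\ x = pline u, y = pline v & form u v = 0].

Lemma formZl (a : F) (u v : H) : form (a *: u) v = a * form u v.
Proof.
by have := form_linearl a 0 u 0 v; rewrite scale0r mul0r !addr0.
Qed.

Lemma formZr (a : F) (u v : H) : form u (a *: v) = form u v * s a.
Proof.
have s0 : s 0 = 0 by apply: (addIr (s 0)); rewrite -starD !add0r.
by have := form_linearr a 0 v 0 u; rewrite scale0r s0 mulr0 !addr0.
Qed.

Lemma pperp_pline (u v : H) : pperp (pline u) (pline v) <-> form u v = 0.
Proof.
split=> [[u' [v' [/pline_eq uE /pline_eq vE uv0]]]|uv0]; last by exists u, v.
have [a ->] : line u' u by rewrite -uE; exact: line_refl.
have [b ->] : line v' v by rewrite -vE; exact: line_refl.
by rewrite formZl formZr uv0 mul0r mulr0.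
Qed.

Fact pperp_sym x y : pperp x y -> pperp y x.
Proof.
move=> [u [v [-> -> uv0]]]; exists v, u; split=> //.
have s0 : s 0 = 0 by apply: (addIr (s 0)); rewrite -starD !add0r.
by rewrite form_sym uv0 s0.
Qed.

Fact pperp0x x : pperp (pline 0) x.
Proof.
have [v ->] := plineP x; apply/pperp_pline.
by rewrite -(scale0r (0 : H)) formZl mul0r.
Qed.

Fact pperpxx x : pperp x x <-> x = pline 0.
Proof.
split=> [|->]; last exact: pperp0x.
have [u ->] := plineP x.
by move=> /pperp_pline /form_anisotropic ->.
Qed.

HB.instance Definition _ :=
  isOrthoset.Build (proj H) pperp_sym pperpxx pperp0x.

End ProjectiveOrthoset.

(* P(phi) : <u> |-> <phi u>, computed on a chosen spanning vector; by
   [proj_map_pline] the choice is irrelevant when phi is quasilinear. *)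
Definition proj_map (F1 F2 : sfieldType) (H1 : lmodType F1)
    (H2 : lmodType F2) (phi : H1 -> H2) : proj H1 -> proj H2 :=
  fun x => pline (phi (prepr x)).

Definition induced_by (F1 F2 : sfieldType) (H1 : lmodType F1)
    (H2 : lmodType F2) (g : proj H1 -> proj H2) (phi : H1 -> H2) : Prop :=
  forall u : H1, g (pline u) = pline (phi u).

Lemma proj_map_pline (F1 F2 : sfieldType) (H1 : lmodType F1)
    (H2 : lmodType F2) (phi : H1 -> H2) :
  quasilinear phi -> induced_by (proj_map phi) phi.
Proof.
move=> [_ [sigma _ phiZ]] u; rewrite /proj_map; apply/pline_eq.
have sub (v w : H1) : line w v -> line (phi v) `<=` line (phi w).
  by move=> [a ->] z [b ->]; exists (b * sigma a); rewrite phiZ scalerA.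
have /pline_eq lE := preprK (pline u).
by apply/seteqP; split; apply: sub; [rewrite -lE|rewrite lE]; exact: line_refl.
Qed.

(* Main.v *)
Require Import Defs.
From HB Require Import structures.
From mathcomp Require Import all_boot all_algebra.
From mathcomp Require Import boolp classical_sets cardinality.

(* Take for H2' the group H2 with everything pulled back along the scalar
   isomorphism sigma: scalars act by a *: v := sigma a *: v, and the form and
   the involution are (u, v)' := sigma^-1 (u, v) and
   a^*' := sigma^-1 ((sigma a)^* ).  The lines and the orthogonality relation
   are unchanged, so t is the identity on lines, and phi itself becomes
   linear. *)

Set Implicit Arguments.
Unset Strict Implicit.
Unset Printing Implicit Defensive.

Import GRing.Theory.
Local Open Scope ring_scope.

Section Pullback.
Context (F1 F2 : sfieldType) (sigma : {rmorphism F1 -> F2}) (tau : F2 -> F1).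
Hypotheses (sigmaK : cancel sigma tau) (tauK : cancel tau sigma).

(** [tau] is a bare two-sided inverse, so its compatibility with the operations is recovered by
    applying the injective [sigma] to both sides. *)
Lemma inv_rmorphD : {morph tau : a b / a + b}.
Proof. by move=> a b; apply: (can_inj sigmaK); rewrite rmorphD !tauK. Qed.

Lemma inv_rmorphM : {morph tau : a b / a * b}.
Proof. by move=> a b; apply: (can_inj sigmaK); rewrite rmorphM !tauK. Qed.

Definition pullback_star (s : involution F2) (a : F1) : F1 := tau (s (sigma a)).

Lemma pullback_starD s : {morph pullback_star s : a b / a + b}.
Proof. by move=> a b; rewrite /pullback_star rmorphD starD inv_rmorphD. Qed.

Lemma pullback_starM s a b :
  pullback_star s (a * b) = pullback_star s b * pullback_star s a.
Proof. by rewrite /pullback_star rmorphM starM inv_rmorphM. Qed.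

Lemma pullback_starK s : involutive (pullback_star s).
Proof. by move=> a; rewrite /pullback_star tauK starK sigmaK. Qed.

Definition pullback_involution s : involution F1 :=
  Involution (@pullback_starD s) (@pullback_starM s) (@pullback_starK s).

(* The cancellation proofs are parameters of the alias so that the Hermitian
   instance below can be inferred from the type. *)
Definition pullback (_ : cancel sigma tau) (_ : cancel tau sigma)
  (V : Type) : Type := V.

Local Notation pb := (pullback sigmaK tauK).

HB.instance Definition _ (V : lmodType F2) := GRing.Zmodule.on (pb V).

Section Module.
Context (V : lmodType F2).

Definition pullback_scale (a : F1) (v : pb V) : pb V := sigma a *: (v : V).

Fact pullback_scaleA a b v :
  pullback_scale a (pullback_scale b v) = pullback_scale (a * b) v.
Proof. by rewrite /pullback_scale scalerA rmorphM. Qed.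

Fact pullback_scale1 : left_id 1 pullback_scale.
Proof. by move=> v; rewrite /pullback_scale rmorph1 scale1r. Qed.

Fact pullback_scaleDr : right_distributive pullback_scale +%R.
Proof. by move=> a u v; rewrite /pullback_scale -scalerDr. Qed.

Fact pullback_scaleDl v : {morph pullback_scale^~ v : a b / a + b}.
Proof. by move=> a b; rewrite /pullback_scale rmorphD scalerDl. Qed.

HB.instance Definition _ := GRing.Zmodule_isLmodule.Build F1 (pb V)
  pullback_scaleA pullback_scale1 pullback_scaleDr pullback_scaleDl.

Lemma pullback_scaleE (a : F1) (v : pb V) :
  a *: v = (sigma a *: (v : V)) :> V.
Proof. by []. Qed.

(** Surjectivity of [sigma] is what matters: every coefficient in [F2] is [sigma] of one in [F1], so
    both actions give [v] the same multiples. *)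
Lemma line_pullback (v : V) : line (v : pb V) = line v.
Proof.
apply/seteqP; split=> w [a ->]; first by exists (sigma a).
by exists (tau a); rewrite pullback_scaleE tauK.
Qed.

End Module.

Section Hermitian.
Context (s : involution F2) (H : hermitianSpaceType s).

Definition pullback_form (u v : pb H) : F1 := tau (Defs.form (u : H) (v : H)).

(** [tau] is injective and fixes 0. Anisotropy, the countability condition and the preservation of
    orthogonality all transfer through this equivalence. *)
Fact pullback_form_eq0 u v : pullback_form u v = 0 <-> Defs.form (u : H) v = 0.
Proof.
have tau0 : tau 0 = 0 by rewrite -(rmorph0 sigma) sigmaK.
by rewrite /pullback_form -tau0; split=> [/(can_inj tauK)|->].
Qed.

Fact pullback_form_linearl (a b : F1) (u v w : pb H) :
  pullback_form (a *: u + b *: v) w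
  = a * pullback_form u w + b * pullback_form v w.
Proof.
(* The coefficients are given explicitly: scaling by [a] in [pb H] is, by conversion, scaling by
   [sigma a] in [H]. *)
rewrite /pullback_form (form_linearl (sigma a) (sigma b) (u : H) v w).
by rewrite inv_rmorphD !inv_rmorphM !sigmaK.
Qed.

Fact pullback_form_linearr (a b : F1) (u v w : pb H) :
  pullback_form w (a *: u + b *: v)
  = pullback_form w u * pullback_involution s a
    + pullback_form w v * pullback_involution s b.
Proof.
rewrite /pullback_form (form_linearr (sigma a) (sigma b) (u : H) v w).
(* Unlike on the left, nothing has to cancel: the scalar [tau (s (sigma a))] is the new involution
   at [a] by definition. *)
by rewrite inv_rmorphD !inv_rmorphM.
Qed.

Fact pullback_form_sym (u v : pb H) :
  pullback_form u v = pullback_involution s (pullback_form v u).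
Proof. by rewrite /= /pullback_star /pullback_form tauK -form_sym. Qed.

Fact pullback_form_anisotropic (u : pb H) : pullback_form u u = 0 -> u = 0.
Proof. by move=> /pullback_form_eq0 /form_anisotropic. Qed.

Fact pullback_orthogonal_countable (S : set (pb H)) :
  (forall u, S u -> u <> 0) ->
  (forall u v, S u -> S v -> u <> v -> pullback_form u v = 0) ->
  countable S.
Proof.
move=> S0 Sperp; apply: (@orthogonal_countable _ _ H) => // u v Su Sv uv.
exact/pullback_form_eq0/Sperp.
Qed.

HB.instance Definition _ :=
  isHermitianSpace.Build F1 (pullback_involution s) (pb H)
    pullback_form_linearl pullback_form_linearr pullback_form_sym
    pullback_form_anisotropic pullback_orthogonal_countable.

(** Morally the identity on subsets; it passes through a representative because an element of [proj]
    carries a proof that refers to the scalar action. *)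
Definition proj_pullback (x : proj H) : proj (pb H) :=
  pline (prepr x : pb H).

Lemma proj_pullback_pline (u : H) :
  proj_pullback (pline u) = pline (u : pb H).
Proof.
have /pline_eq lineE := preprK (pline u).
by apply/pline_eq; rewrite !line_pullback.
Qed.

Lemma proj_pullback_orthoisomorphism : orthoisomorphism proj_pullback.
Proof.
split.
  (* The inverse is the same recipe backwards; the representative chosen in [pb H] may differ from
     [u], but it spans the same line for both actions. *)
  exists (fun y : proj (pb H) => pline (prepr y : H)) => x.
    have [u ->] := plineP x; rewrite proj_pullback_pline.
    have /pline_eq lineE := preprK (pline (u : pb H)).
    by apply/pline_eq; rewrite -!line_pullback.
  by rewrite proj_pullback_pline preprK.
move=> x y; have [u ->] := plineP x; have [v ->] := plineP y.
rewrite !proj_pullback_pline; split=> /pperp_pline uv0; apply/pperp_pline.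
  exact/pullback_form_eq0.
by apply/pullback_form_eq0.
Qed.

End Hermitian.
End Pullback.

Theorem lemma3p22 (F1 F2 : sfieldType) (s1 : involution F1)
    (s2 : involution F2) (H1 : hermitianSpaceType s1)
    (H2 : hermitianSpaceType s2) (phi : H1 -> H2) (phi_ql : quasilinear phi) :
  exists (s : involution F1) (H2' : hermitianSpaceType s)
      (t : proj H2 -> proj H2') (phi' : {linear H1 -> H2'}),
    orthoisomorphism t /\ induced_by (t \o proj_map phi) phi'.
Proof.
have [phiD [sigma [tau sigmaK tauK] phiZ]] := phi_ql.
pose H2' : hermitianSpaceType _ := pullback sigmaK tauK H2.
(* The factor [sigma a] produced by quasilinearity is absorbed by conversion into the action of [a]
   on [H2']. *)
have phi_lin : linear (phi : H1 -> H2') by move=> a u v; rewrite phiD phiZ.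
pose phi_mixin := GRing.isLinear.Build F1 H1 H2' *:%R phi phi_lin.
pose phi' : {linear H1 -> H2'} := HB.pack (phi : H1 -> H2') phi_mixin.
exists (pullback_involution sigmaK tauK s2), H2',
  (@proj_pullback _ _ _ _ sigmaK tauK _ H2), phi'.
split; first exact: proj_pullback_orthoisomorphism.
by move=> u; rewrite /= proj_map_pline // proj_pullback_pline.
Qed.
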